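(* Let $n=p+q$, let $\mu\in Cl_{(p,q)}$ satisfy $\mu^2=-1$, and let $T,\Omega$ be measurable subsets of $\mathbb{R}^n$. Let $\frac1a+\frac1b=1$. If a non-zero function $f\in L^1\cap L^a(\mathbb{R}^n,Cl_{(p,q)})$ is $\varepsilon_T$-concentrated on $T$ in $L^a$-norm, and $\mathcal{F}^\mu\{f\}$ is $\varepsilon_\Omega$-concentrated on $\Omega$ in $L^b$-norm, then $$\|\mathcal{F}^\mu\{f\}\|_b\le\frac{C_\mu2^n|T|^{\frac1b}|\Omega|^{\frac1b}+C_h\,\varepsilon_T}{1-\varepsilon_\Omega}\,\|f\|_a,$$ where $C_\mu=(1+|\mu|^2)^{1/2}$ and $C_h=(2^nC_\mu)^{1-\frac2b}(2\pi)^{\frac{2n}{b}}$.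
   Context: $Cl_{(p,q)}$ is the real associative Clifford algebra of dimension $2^n$ ($n=p+q$) generated by $e_1,\dots,e_n$ with $e_ke_l+e_le_k=2\epsilon_k\delta_{k,l}$, where $\epsilon_k=+1$ for $1\le k\le p$ and $\epsilon_k=-1$ for $p<k\le n$. Its basis consists of $e_A=e_{\alpha_1}\cdots e_{\alpha_k}$ for $A=\{\alpha_1<\dots<\alpha_k\}\subseteq\{1,\dots,n\}$, with $e_\emptyset=1$. The modulus of $\lambda=\sum_A\lambda_Ae_A$ (with $\lambda_A\in\mathbb{R}$) is $|\lambda|=\big(\sum_A\lambda_A^2\big)^{1/2}$. For $1\le a<\infty$, $L^a(\mathbb{R}^n,Cl_{(p,q)})$ is the space of functions $f:\mathbb{R}^n\to Cl_{(p,q)}$ with $\|f\|_a=\big(\int_{\mathbb{R}^n}|f(t)|^a\,dt\big)^{1/a}<\infty$; for $a=\infty$, $\|f\|_\infty=\operatorname{ess\,sup}_t|f(t)|$. Clifford Fourier transform: for $f\in L^1(\mathbb{R}^n,Cl_{(p,q)})$, $\mathcal{F}^\mu\{f\}(\xi)=\int_{\mathbb{R}^n}f(t)e^{-\mu u(t,\xi)}\,dt$, where $u(t,\xi)=\sum_{l=1}^nt_l\xi_l$ and $e^{\theta\mu}=\cos\theta+\mu\sin\theta$ for $\theta\in\mathbb{R}$. The number $C_h$ is the constant of the Hausdorff-Young inequality $\|\mathcal{F}^\mu\{f\}\|_b\le C_h\|f\|_a$ for this transform. A function $g$ is $\varepsilon$-concentrated on a measurable set $E\subseteq\mathbb{R}^n$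 in $L^c$-norm if $\big(\int_{\mathbb{R}^n\setminus E}|g(t)|^c\,dt\big)^{1/c}\le\varepsilon\|g\|_c$. $|E|$ denotes the Lebesgue measure of a set $E$.
   Formalization: The Hausdorff–Young inequality with the displayed constant C_h is assumed for the given μ, a, b (as the role of C_h requires; it fails, and with it the bound, for some μ with μ²=−1 and large |μ|), and ε_Ω < 1 is assumed. *)

(* Defs.v *)
From HB Require Import structures.
From mathcomp Require Import all_boot all_order all_algebra.
From mathcomp Require Import all_classical all_reals all_analysis.
From mathcomp Require Import ring.

Set Implicit Arguments.
Unset Strict Implicit.
Unset Printing Implicit Defensive.

Import Order.TTheory GRing.Theory Num.Theory.
Import numFieldNormedType.Exports.

Local Open Scope ring_scope.

(* The Clifford algebra Cl(p,q): the coefficient at A of lambda is lambda A,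
   and A ranges over the subsets of {0, ..., p+q-1} (indices are shifted by
   one).  The carrier uses R^o only to inherit the R-module structure. *)
Definition clifford (R : realType) (p q : nat) : Type :=
  {ffun {set 'I_(p + q)} -> R^o}.

HB.instance Definition _ (R : realType) (p q : nat) :=
  GRing.Lmodule.copy (clifford R p q) {ffun {set 'I_(p + q)} -> R^o}.

Section CliffordAlgebra.
Variables (R : realType) (p q : nat).
Local Notation I := 'I_(p + q).
Local Notation Cl := (clifford R p q).
Implicit Types (i j k l : I) (A B C D : {set I}) (x y z : Cl).

Definition coef (x : Cl) (A : {set I}) : R := x A.

Definition cl_eps (i : I) : R := if (i < p)%N then 1 else -1.

(* e_i e_j = (e_j e_i) * swap_sign i j when j < i, and e_i e_i = swap_sign i i *)
Definition swap_sign (i j : I) : R :=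
  if (j < i)%N then -1 else if i == j then cl_eps i else 1.

Definition blade_sign (A B : {set I}) : R :=
  \prod_(i in A) \prod_(j in B) swap_sign i j.

Definition symdiff (A B : {set I}) : {set I} :=
  [set i | (i \in A) (+) (i \in B)].

(* The bilinear extension of e_A e_B = blade_sign A B e_(A symdiff B):
   the pairs (A, B) with A symdiff B = C are the (A, A symdiff C). *)
Definition cl_mul (x y : Cl) : Cl :=
  [ffun C => \sum_A blade_sign A (symdiff A C) * (x A * y (symdiff A C))].

Definition blade (A : {set I}) : Cl := [ffun B => (B == A)%:R].

Definition cl_one : Cl := blade finset.set0.

Definition gen (k : I) : Cl := blade [set k].

Lemma coefE x A : coef x A = x A. Proof. by []. Qed.

Lemma symdiffC A B : symdiff A B = symdiff B A.
Proof. by apply/setP => i; rewrite !inE addbC. Qed.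

Lemma symdiffA A B C : symdiff A (symdiff B C) = symdiff (symdiff A B) C.
Proof. by apply/setP => i; rewrite !inE addbA. Qed.

Lemma symdiffK A : cancel (symdiff A) (symdiff A).
Proof. by move=> B; apply/setP => i; rewrite !inE addKb. Qed.

Lemma symdiff0 A : symdiff A finset.set0 = A.
Proof. by apply/setP => i; rewrite !inE addbF. Qed.

Lemma symdiffv A : symdiff A A = finset.set0.
Proof. by apply/setP => i; rewrite !inE addbb. Qed.

Lemma swap_sign_sqr i j : swap_sign i j * swap_sign i j = 1.
Proof.
rewrite /swap_sign /cl_eps.
by do ![case: ifP => _]; rewrite ?mulr1 // mulrNN mulr1.
Qed.

Lemma prod_symdiff (F : I -> R) A B : (forall i, F i * F i = 1) ->
  \prod_(i in symdiff A B) F i = (\prod_(i in A) F i) * \prod_(i in B) F i.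
Proof.
move=> F1; rewrite !(big_mkcond (fun i => i \in _)) -big_split /=.
apply: eq_bigr => i _; rewrite inE.
by case: (i \in A); case: (i \in B) => /=; rewrite ?mulr1 ?mul1r ?F1.
Qed.

Lemma blade_signDl A B C :
  blade_sign (symdiff A B) C = blade_sign A C * blade_sign B C.
Proof.
apply: prod_symdiff => i; rewrite -big_split /=.
by apply: big1 => j _; exact: swap_sign_sqr.
Qed.

Lemma blade_signDr A B C :
  blade_sign A (symdiff B C) = blade_sign A B * blade_sign A C.
Proof.
rewrite /blade_sign -big_split; apply: eq_bigr => i _ /=.
by apply: prod_symdiff => j; exact: swap_sign_sqr.
Qed.

Lemma blade_sign0l A : blade_sign finset.set0 A = 1.
Proof. by rewrite /blade_sign big_set0. Qed.

Lemma blade_sign0r A : blade_sign A finset.set0 = 1.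
Proof. by apply: big1 => i _; rewrite big_set0. Qed.

Fact cl_mulA : associative cl_mul.
Proof.
move=> x y z; apply/ffunP => D; rewrite !ffunE.
under eq_bigr => A _.
  rewrite ffunE mulr_sumr mulr_sumr.
  over.
under [RHS]eq_bigr => C _.
  rewrite ffunE mulr_suml mulr_sumr.
  over.
rewrite [RHS]exchange_big /=; apply: eq_bigr => A _.
rewrite [RHS](reindex_inj (can_inj (symdiffK A))) /=.
apply: eq_bigr => B _; rewrite symdiffK.
have -> : symdiff B (symdiff A D) = symdiff (symdiff A B) D.
  by rewrite symdiffA (symdiffC B).
set E := symdiff (symdiff A B) D.
have -> : symdiff A D = symdiff B E.
  by rewrite /E (symdiffC A B) -symdiffA symdiffK.
rewrite blade_signDl blade_signDr.
move: (blade_sign A B) (blade_sign A E) (blade_sign B E) => a b c.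
by move: (x A : R) (y B : R) (z E : R) => u v w; ring.
Qed.

Fact cl_mul1l : left_id cl_one cl_mul.
Proof.
move=> x; apply/ffunP => C; rewrite ffunE (bigD1 finset.set0) //=.
rewrite ffunE eqxx blade_sign0l !mul1r big1 => [|A /negPf A0].
  by rewrite addr0 symdiffC symdiff0.
by rewrite ffunE A0 mul0r mulr0.
Qed.

Fact cl_mul1r : right_id cl_one cl_mul.
Proof.
move=> x; apply/ffunP => C; rewrite ffunE (bigD1 C) //=.
rewrite symdiffv ffunE eqxx blade_sign0r mul1r mulr1 big1 ?addr0 // => A AC.
rewrite ffunE; case: eqP => [AC0|_]; last by rewrite !mulr0.
by case/eqP: AC; rewrite -[RHS](symdiffK A) AC0 symdiff0.
Qed.

Fact cl_mulDl : left_distributive cl_mul +%R.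
Proof.
move=> x y z; apply/ffunP => C; rewrite !ffunE -big_split /=.
by apply: eq_bigr => A _; rewrite ffunE mulrDl mulrDr.
Qed.

Fact cl_mulDr : right_distributive cl_mul +%R.
Proof.
move=> x y z; apply/ffunP => C; rewrite !ffunE -big_split /=.
by apply: eq_bigr => A _; rewrite ffunE mulrDr mulrDr.
Qed.

Fact cl_one_neq0 : cl_one != 0.
Proof.
apply/eqP => /ffunP/(_ finset.set0); rewrite !ffunE eqxx.
by move/eqP; rewrite oner_eq0.
Qed.

HB.instance Definition _ := GRing.Zmodule_isNzRing.Build Cl
  cl_mulA cl_mul1l cl_mul1r cl_mulDl cl_mulDr cl_one_neq0.

Fact cl_scalerAl (a : R) x y : a *: (x * y) = (a *: x) * y.
Proof.
apply/ffunP => C; rewrite !ffunE scaler_sumr; apply: eq_bigr => A _.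
by rewrite ffunE /GRing.scale /= mulrCA !mulrA.
Qed.

HB.instance Definition _ := GRing.Lmodule_isLalgebra.Build R Cl cl_scalerAl.

Fact cl_scalerAr (a : R) x y : a *: (x * y) = x * (a *: y).
Proof.
apply/ffunP => C; rewrite !ffunE scaler_sumr; apply: eq_bigr => A _.
by rewrite ffunE /GRing.scale /= mulrCA [in RHS](mulrCA (x A)).
Qed.

HB.instance Definition _ := GRing.Lalgebra_isAlgebra.Build R Cl cl_scalerAr.

Lemma blade0 : blade finset.set0 = 1. Proof. by []. Qed.

Lemma cl_decomp x : x = \sum_A coef x A *: blade A.
Proof.
apply/ffunP => C; rewrite sum_ffunE (bigD1 C) //= !ffunE eqxx.
rewrite big1 ?addr0 ?/GRing.scale /= ?mulr1 // => A AC.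
by rewrite !ffunE eq_sym (negPf AC) /GRing.scale /= mulr0.
Qed.

Lemma mul_blade A B :
  blade A * blade B = blade_sign A B *: blade (symdiff A B).
Proof.
apply/ffunP => C; rewrite !ffunE (bigD1 A) //= big1 ?addr0 => [|D DA].
  rewrite !ffunE eqxx mul1r /GRing.scale /=.
  have -> : (symdiff A C == B) = (C == symdiff A B).
    by rewrite -(inj_eq (can_inj (symdiffK A))) symdiffK.
  case: eqP => [->|_]; last by rewrite !mulr0.
  by rewrite symdiffK.
by rewrite ffunE (negPf DA) mul0r mulr0.
Qed.

Lemma gen_clifford k l :
  gen k * gen l + gen l * gen k = (2 * cl_eps k * (k == l)%:R)%:A.
Proof.
rewrite !mul_blade (symdiffC [set l]) -scalerDl /blade_sign !big_set1.
have [->|kl] := eqVneq k l.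
  by rewrite symdiffv /swap_sign ltnn eqxx mulr1 mulr_natl mulr2n.
rewrite mulr0 scale0r /swap_sign [l == k]eq_sym (negPf kl).
have := kl; rewrite -val_eqE /=.
by case: ltngtP => // _ _; rewrite ?addNr ?subrr scale0r.
Qed.

Let lt_ord (i j : I) := (i < j)%N.

Let prod_gen (s : seq I) :
  sorted lt_ord s -> \prod_(k <- s) gen k = blade [set k in s].
Proof.
have lt_trans : transitive lt_ord by move=> ? ? ?; exact: ltn_trans.
elim: s => [|i s IH] /=; first by rewrite big_nil finset.set_nil.
move=> is_sorted; have lt_is := order_path_min lt_trans is_sorted.
rewrite big_cons IH ?(path_sorted is_sorted) // mul_blade.
rewrite /blade_sign big_set1 big1 => [|j]; last first.
  rewrite inE => /(allP lt_is) ltij; rewrite /swap_sign.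
  by rewrite ltnNge (ltnW ltij) -val_eqE /= ltn_eqF.
rewrite scale1r; congr blade; apply/setP => j; rewrite !inE.
by have [->|//] := eqVneq j i; case: (boolP (i \in s)) => // /(allP lt_is);
  rewrite /lt_ord ltnn.
Qed.

Lemma bladeE A : blade A = \prod_(k <- enum A) gen k.
Proof.
rewrite prod_gen; last first.
  rewrite /enum_mem sorted_filter //; first by move=> ? ? ?; exact: ltn_trans.
  have := iota_ltn_sorted 0 (p + q).
  by rewrite -val_enum_ord sorted_map enumT.
by congr blade; apply/setP => k; rewrite inE mem_enum.
Qed.

End CliffordAlgebra.

Local Open Scope classical_set_scope.

Section LebesgueMeasureRn.
Variable R : realType.
Local Notation Rm := (measurableTypeR R).

Definition tcons n (z : Rm * n.-tuple Rm) : n.+1.-tuple Rm :=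
  [tuple of z.1 :: z.2].

Definition tuncons n (t : n.+1.-tuple Rm) : Rm * n.-tuple Rm :=
  (thead t, [tuple of behead t]).

Lemma tconsK n : cancel (@tcons n) (@tuncons n).
Proof.
move=> [x t]; rewrite /tuncons /tcons /=; congr (_, _).
by apply/val_inj.
Qed.

Lemma tunconsK n : cancel (@tuncons n) (@tcons n).
Proof. by move=> t; rewrite [RHS]tuple_eta; apply/val_inj. Qed.

Lemma measurable_tcons n : measurable_fun [set: Rm * n.-tuple Rm] (@tcons n).
Proof. exact: measurable_cons. Qed.

Lemma measurable_tuncons n :
  measurable_fun [set: n.+1.-tuple Rm] (@tuncons n).
Proof.
apply: measurable_fun_pair; last exact: measurable_behead.
exact: measurable_tnth.
Qed.

Section step.
Variables (n : nat) (m : {sigma_finite_measure set (n.-tuple Rm) -> \bar R}).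

Definition tcons_measure : set (n.+1.-tuple Rm) -> \bar R :=
  pushforward (lebesgue_measure \x m)%E (@tcons n).

Let tcons_measure0 : tcons_measure set0 = 0%E.
Proof. by rewrite /tcons_measure /pushforward preimage_set0 measure0. Qed.

Let tcons_measure_ge0 A : (0 <= tcons_measure A)%E.
Proof. exact: (measure_ge0 (lebesgue_measure \x m)%E). Qed.

Let tcons_measure_sigma_additive : semi_sigma_additive tcons_measure.
Proof.
move=> F mF tF mUF; rewrite /tcons_measure /pushforward preimage_bigcup.
have mpre X : measurable X -> measurable (@tcons n @^-1` X).
  by move=> mX; rewrite -[X in measurable X]setTI; exact: measurable_tcons.
apply: measure_semi_sigma_additive => [k||]; first exact: mpre.
  apply/trivIsetP => i j _ _ ij; rewrite -preimage_setI.
  by move/trivIsetP : tF => /(_ _ _ _ _ ij) -> //; rewrite preimage_set0.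
by rewrite -preimage_bigcup; exact: mpre.
Qed.

HB.instance Definition _ := isMeasure.Build _ _ _ tcons_measure
  tcons_measure0 tcons_measure_ge0 tcons_measure_sigma_additive.

Let tcons_measure_sigma_finite : sigma_finite setT tcons_measure.
Proof.
have /sigma_finiteP[F [TF ndF Foo]] := sigma_finiteT (@lebesgue_measure R).
have /sigma_finiteP[G [TG ndG Goo]] := sigma_finiteT m.
exists (fun k => @tuncons n @^-1` (F k `*` G k)).
  rewrite -preimage_bigcup -[LHS](preimage_setT (@tuncons n)).
  congr (_ @^-1` _); rewrite -setXTT TF TG; apply/seteqP; split => -[x y].
    move=> [/= [i _ Fix] [j _ Gjy]]; exists (maxn i j) => //; split.
    - by move: x Fix; exact/subsetPset/ndF/leq_maxl.
    - by move: y Gjy; exact/subsetPset/ndG/leq_maxr.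
  by move=> [i _ []/= ? ?]; split; exists i.
move=> k; have [mF Fk] := Foo k; have [mG Gk] := Goo k; split.
  rewrite -[X in measurable X]setTI; apply: measurable_tuncons => //.
  exact: measurableX.
rewrite /tcons_measure /pushforward -comp_preimage.
have -> : @tuncons n \o @tcons n = id by apply/funext => z; rewrite /= tconsK.
rewrite preimage_id product_measure1E // lte_mul_pinfty // ge0_fin_numE //.
Qed.

HB.instance Definition _ := Measure_isSigmaFinite.Build _ _ _ tcons_measure
  tcons_measure_sigma_finite.

End step.

Fixpoint borel_lebesgue n : {sigma_finite_measure set (n.-tuple Rm) -> \bar R} :=
  match n with
  | 0 => dirac [tuple]
  | m.+1 => tcons_measure (borel_lebesgue m)
  end.


(* borel_lebesgue n is the n-fold product of lebesgue_measure on the Borel sets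
   of R^n; Rn n carries the larger sigma-algebra of Lebesgue measurable sets,
   i.e. the Caratheodory sets of the induced outer measure. *)
Definition Rn n : measurableType _ :=
  caratheodory_type (mu_ext (borel_lebesgue n)).

Definition lebesgue n : set (Rn n) -> \bar R :=
  @completed_measure_extension _ (n.-tuple Rm) R (borel_lebesgue n).

HB.instance Definition _ n := Measure.on (@lebesgue n).

Let lebesgue_sigma_finite n : sigma_finite setT (@lebesgue n).
Proof.
exact: (completed_measure_extension_sigma_finite
  (sigma_finiteT (borel_lebesgue n))).
Qed.

HB.instance Definition _ n := Measure_isSigmaFinite.Build _ _ _ (@lebesgue n)
  (@lebesgue_sigma_finite n).

Let box n (A : 'I_n -> set Rm) : set (n.-tuple Rm) :=
  [set t | forall l, A l (tnth t l)].

Let measurable_box n (A : 'I_n -> set Rm) :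
  (forall l, measurable (A l)) -> measurable (box A).
Proof.
move=> mA.
have -> : box A = \bigcap_(l in [set: 'I_n]) (fun t => tnth t l) @^-1` A l.
  by apply/seteqP; split => t /= At l => [_|]; exact: At.
apply: fin_bigcap_measurable => // l _; rewrite -[X in measurable X]setTI.
exact: measurable_tnth.
Qed.

Lemma lebesgue_box n (A : 'I_n -> set Rm) : (forall l, measurable (A l)) ->
  @lebesgue n [set t | forall l, A l (tnth t l)] =
  (\prod_(l < n) lebesgue_measure (A l))%E.
Proof.
move=> mA; rewrite /lebesgue /completed_measure_extension.
rewrite (measurable_mu_extE (borel_lebesgue n)); last exact: measurable_box.
elim: n => [|n IH] in A mA *.
  by rewrite big_ord0 /= diracE mem_set // => -[].
rewrite big_ord_recl -IH // /= /tcons_measure /pushforward.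
rewrite -product_measure1E //; last first.
  exact: (@measurable_box n (fun l => A (lift ord0 l))).
congr ((_ \x _)%E _); apply/seteqP; split => -[x t] /=.
  move=> At; split => [|l]; first exact: (At ord0).
  by have := At (lift ord0 l); rewrite tnthS.
move=> [Ax At] l; case: (unliftP ord0 l) => [k ->|->//].
by rewrite tnthS; exact: At.
Qed.

Lemma measurable_coordinate n (l : 'I_n) :
  measurable_fun [set: Rn n] (fun t : n.-tuple R => tnth t l).
Proof.
move=> _ Y mY; rewrite setTI; apply: caratheodory_measurable_mu_ext.
by rewrite -[X in measurable X]setTI; exact: measurable_tnth.
Qed.

Definition dotp n (s t : n.-tuple R) : R := \sum_(l < n) tnth s l * tnth t l.

End LebesgueMeasureRn.

Arguments lebesgue {R n}.

Section CliffordAnalysis.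
Variables (R : realType) (p q : nat).
Local Notation Cl := (clifford R p q).
Local Notation space := (Rn R (p + q)).
Implicit Types (f g : space -> Cl) (mu x : Cl) (a b : \bar R).

Definition modulus (x : Cl) : R := Num.sqrt (\sum_A coef x A ^+ 2).

Definition cl_measurable (f : space -> Cl) : Prop :=
  forall A, measurable_fun [set: space] (fun t => coef (f t) A).

(* 'N_+oo is the essential supremum. *)
Definition cl_norm (a : \bar R) (f : space -> Cl) : \bar R :=
  Lnorm lebesgue a (fun t => (modulus (f t))%:E).

Definition mem_L (a : \bar R) (f : space -> Cl) : Prop :=
  cl_measurable f /\ (cl_norm a f < +oo)%E.

Definition cl_integral (f : space -> Cl) : Cl :=
  [ffun A => (\int[lebesgue]_t coef (f t) A)%R].

(* e^(theta mu), when mu^2 = -1 *)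
Definition cl_cis (mu : Cl) (theta : R) : Cl :=
  (cos theta)%:A + sin theta *: mu.

Definition fourier (mu : Cl) (f : space -> Cl) (xi : space) : Cl :=
  cl_integral (fun t => f t * cl_cis mu (- dotp t xi)).

Definition concentrated (eps : R) (E : set space) (c : \bar R)
    (g : space -> Cl) : Prop :=
  (Lnorm lebesgue c ((fun t => (modulus (g t))%:E) \_ (~` E)) <=
   eps%:E * cl_norm c g)%E.

(* C is a constant of the Hausdorff-Young inequality for the exponents a, b.
   With C = C_h mu b it holds trivially for a = 1, b = +oo, but it is not a
   consequence of mu^2 = -1: for n = 2, p = q = 1, a = b = 2,
   mu = cosh(s) e_2 + sinh(s) e_1 and f(t) = t_1 exp(-|t|^2/2), the norm of the
   transform is |mu| 2pi ||f||, which exceeds C_h ||f|| = (2pi)^2 ||f|| for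
   large s. *)
Definition hausdorff_young (mu : Cl) (a b : \bar R) (C : R) : Prop :=
  forall g, mem_L 1 g -> mem_L a g ->
    (cl_norm b (fourier mu g) <= C%:E * cl_norm a g)%E.

Definition C_mu (mu : Cl) : R := Num.sqrt (1 + modulus mu ^+ 2).

(* 1/b is fine b^-1, which is 0 when b = +oo. *)
Definition C_h (mu : Cl) (b : \bar R) : R :=
  (2 ^+ (p + q) * C_mu mu) `^ (1 - 2 * fine b^-1%E) *
  (2 * pi) `^ (2 * (p + q)%:R * fine b^-1%E).

End CliffordAnalysis.

(* Main.v *)
Require Import Defs.
From mathcomp Require Import all_boot all_order all_algebra.
From mathcomp Require Import all_classical all_reals all_analysis.
From mathcomp Require Import ess_sup_inf measurable_realfun.
From mathcomp Require Import ring.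

Set Implicit Arguments.
Unset Strict Implicit.
Unset Printing Implicit Defensive.

Import Order.TTheory GRing.Theory Num.Theory.
Import numFieldNormedType.Exports.

Local Open Scope classical_set_scope.
Local Open Scope ring_scope.

(* Split F f over Omega and its complement, and f over T and its complement.
   The part of F f off Omega is at most epsO ||F f||_b, and it is absorbed in
   the left-hand side because ||F f||_b is finite.  On Omega, the transform of
   1_(~T) f is controlled by the Hausdorff-Young inequality, and that of 1_T f
   is at most C_mu 2^n ||1_T f||_1 pointwise, where ||1_T f||_1 is at most
   |T|^(1/b) ||f||_a by Hoelder. *)

(** * Norms of real functions, and Hoelder's inequality against an indicator *)

Section Lnorm_real.
Context d (T : measurableType d) (R : realType).
Variable m : {measure set T -> \bar R}.
Implicit Types (f g : T -> R) (a b : \bar R) (E : set T).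

Lemma le_Lnorm a f g : (0 < a)%E ->
  measurable_fun setT f -> measurable_fun setT g ->
  (forall x, `|f x| <= `|g x|) ->
  (Lnorm m a (EFin \o f) <= Lnorm m a (EFin \o g))%E.
Proof.
case: a => [r||//]; rewrite ?lte_fin => r0 mf mg fg; rewrite unlock /Lnorm.
  have mpow (h : T -> R) : measurable_fun setT h ->
      measurable_fun setT (fun x => (`|h x| `^ r)%:E).
    move=> mh; apply/measurable_EFinP.
    apply: (@measurableT_comp _ _ _ _ _ _ (@powR R ^~ r)) => //.
    exact: measurableT_comp.
  apply: gt0_ler_poweR; rewrite ?invr_ge0 ?(ltW r0) ?in_itv//= ?leey ?andbT.
  - by apply: integral_ge0 => x _; rewrite lee_fin powR_ge0.
  - by apply: integral_ge0 => x _; rewrite lee_fin powR_ge0.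
  apply: ge0_le_integral => //.
  - exact: mpow.
  - exact: mpow.
  by move=> x _; rewrite lee_fin ge0_ler_powR ?nnegrE ?(ltW r0).
(* At exponent [+oo] the norm is an essential supremum only on a space of positive measure;
   otherwise it is 0 by definition. *)
case: ifPn => // _; apply: le_ess_sup; apply: nearW => x /=.
by rewrite lee_fin.
Qed.

(** Hoelder's inequality for real exponents covers only the third case, so the two endpoint pairs,
    with [1/+oo] read as 0, are split off. *)
Lemma conjugate_cases a b : (1 <= a)%E -> (a^-1 + b^-1 = 1)%E ->
  [\/ a = 1%E /\ b = +oo%E, a = +oo%E /\ b = 1%E |
   exists r s : R, [/\ a = r%:E, b = s%:E, 0 < r, 1 <= s & r^-1 + s^-1 = 1]].
Proof.
move=> a1 ab; have a0 : (0 < a)%E by exact: lt_le_trans a1.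
have bE : b = hoelder_conjugate a.
  by apply/hoelder_conjugateP; rewrite ?gt_eqF// (lt_trans _ a0).
have b1 : (1 <= b)%E by rewrite bE hoelder_conj_ge1.
case: a a1 a0 ab bE => [r||//] a1 a0 ab bE; last first.
  by constructor 2; rewrite bE hoelder_conjugatey.
case: b ab b1 bE => [s||//] ab b1 bE; last first.
  by constructor 1; split => //; exact/hoelder_conjugate_eqy/esym.
constructor 3; exists r, s; split => //.
have s0 : 0 < s by rewrite (lt_le_trans ltr01).
by move: ab; rewrite !inver !gt_eqF// -EFinD => -[].
Qed.

Lemma conjugate_ge1 a b : (1 <= a)%E -> (a^-1 + b^-1 = 1)%E -> (1 <= b)%E.
Proof.
move=> a1 /(conjugate_cases a1)[[_ ->]|[_ ->]|[r [s [_ -> _ s1 _]]]] //.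
by rewrite leey.
Qed.

(** For finite [b] the computation gives equality. At [+oo] only an inequality can hold: a null [E]
    makes the norm 0, while [m E] to the power 0 is 1. *)
Lemma Lnorm_indic_le b E (c : R) : (1 <= b)%E -> measurable E -> 0 <= c ->
  (Lnorm m b (EFin \o (fun x => c * \1_E x)%R) <= c%:E * m E `^ fine b^-1)%E.
Proof.
case: b => [r||//] b1 mE c0; last first.
  rewrite invey/= poweRe0 mule1 unlock /Lnorm; case: ifPn => // _.
  apply/ess_supP; apply: nearW => x; rewrite /= lee_fin normrM ger0_norm//.
  rewrite ger0_norm ?indicE ?ler0n//.
  by rewrite -[leRHS]mulr1 ler_wpM2l// lern1 leq_b1.
have r0 : 0 < r by rewrite (lt_le_trans ltr01).
rewrite inver gt_eqF//= unlock /Lnorm.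
under eq_integral => x _.
  rewrite /= normrM (ger0_norm c0) powRM// (_ : `|_| `^ r = \1_E x); last first.
    rewrite indicE; case: (_ \in _); first by rewrite normr1 powR1.
    by rewrite normr0 powR0// gt_eqF.
  rewrite EFinM; over.
rewrite ge0_integralZl//; last 2 first.
- by apply/measurable_EFinP; exact: measurable_indic.
- by rewrite lee_fin powR_ge0.
rewrite integral_indic// setIT poweRM ?measure_ge0 ?lee_fin ?powR_ge0//.
by rewrite -poweR_EFin -poweRrM mulfV ?gt_eqF// poweRe1.
Qed.

(** Hoelder's inequality for the pair [\1_E], [f], with the norm of [\1_E] evaluated. At [a = 1] the
    factor is 1; at [a = +oo] the function is bounded by its essential supremum and integrated over
    [E]. *)
Lemma hoelder_indic a b E f : (1 <= a)%E -> (a^-1 + b^-1 = 1)%E ->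
  measurable E -> measurable_fun setT f ->
  (Lnorm m 1 (EFin \o (fun x => \1_E x * f x)%R) <=
   m E `^ fine b^-1 * Lnorm m a (EFin \o f))%E.
Proof.
move=> a1 ab mE mf; have mi : measurable_fun setT (\1_E : T -> R).
  exact: measurable_indic.
have b1 := conjugate_ge1 a1 ab.
case: (conjugate_cases a1 ab) => [[-> ->]|[-> ->]|[r [s [-> -> r0 s1 rs]]]].
- rewrite invey/= poweRe0 mul1e; apply: le_Lnorm => //.
    exact: measurable_funM.
  move=> x; rewrite normrM -[leRHS]mul1r ler_wpM2r//.
  by rewrite indicE ger0_norm ?ler0n// lern1 leq_b1.
- rewrite inve1/= poweRe1// Lnorm1.
  (* As [0 * +oo = 0], the bound is 0 for a null [E]; then [\1_E * f] vanishes almost everywhere,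
     with [E] as exceptional set. Otherwise the whole space has positive measure and the [+oo]-norm
     is a genuine essential supremum. *)
  have [E0|E0] := eqVneq (m E) 0%E.
    rewrite E0 mul0e (ae_eq_integral (cst 0%E)) ?integral0//.
    - apply/measurable_EFinP; apply: measurableT_comp => //.
      exact: measurable_funM.
    - exists E; split => // x /= /not_implyP[_ h]; apply: contrapT => nEx.
      by apply: h; rewrite indicE memNset//= mul0r normr0.
  have mT : (0 < m setT)%E.
    rewrite (lt_le_trans (y := m E)) ?lt0e ?E0 ?measure_ge0//.
    by apply: le_measure; rewrite ?inE.
  have -> : Lnorm m +oo (EFin \o f) = ess_sup m (abse \o (EFin \o f)).
    by rewrite unlock /Lnorm mT.
  set S := ess_sup _ _.
  have S0 : (0 <= S)%E by apply: ess_sup_gee => //; apply: nearW => x /=.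
  rewrite muleC.
  have [->|Sfin] := eqVneq S +oo%E.
    by rewrite gt0_mulye ?lt0e ?E0 ?measure_ge0// leey.
  have Sf : S \is a fin_num by rewrite ge0_fin_numE// lt_neqAle Sfin leey.
  have -> : m E = (\int[m]_x (\1_E x)%:E)%E by rewrite integral_indic// setIT.
  rewrite -ge0_integralZl//; last exact/measurable_EFinP.
  apply: ae_ge0_le_integral => //.
  - apply/measurable_EFinP; apply: measurableT_comp => //.
    exact: measurable_funM.
  - by move=> x _; rewrite mule_ge0// lee_fin indicE ler0n.
  - by apply: measurable_funeM; exact/measurable_EFinP.
  apply: filterS (ess_sup_ge m (abse \o (EFin \o f))) => x /= fS _.
  rewrite normrM [`|\1_E x|]ger0_norm ?indicE ?ler0n// EFinM muleC.
  by rewrite lee_wpmul2r// lee_fin ler0n.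
have s0 : 0 < s by rewrite (lt_le_trans ltr01).
rewrite (@eq_Lnorm _ _ _ _ _ _ (EFin \o (f \* \1_E)%R)%E); last first.
  by move=> x /=; rewrite mulrC.
apply: le_trans (hoelder m mf mi r0 s0 rs) _.
rewrite muleC; apply: lee_wpmul2r; first exact: Lnorm_ge0.
have := @Lnorm_indic_le s%:E E 1 s1 mE ler01.
rewrite mul1e; apply: le_trans; rewrite le_eqVlt; apply/orP; left; apply/eqP.
by apply: eq_Lnorm => x /=; rewrite mul1r.
Qed.

End Lnorm_real.

(** * The Euclidean modulus on the Clifford algebra *)

Lemma cauchy_schwarz_sum (R : rcfType) (I : finType) (F G : I -> R) :
  `|\sum_i F i * G i| <=
  Num.sqrt (\sum_i F i ^+ 2) * Num.sqrt (\sum_i G i ^+ 2).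
Proof.
have ge0 (H : I -> R) : 0 <= \sum_i H i ^+ 2.
  by apply: sumr_ge0 => i _; exact: sqr_ge0.
rewrite -sqrtrM// -sqrtr_sqr ler_sqrt ?mulr_ge0//.
(* Lagrange's identity: after doubling, the difference of the two sides is the sum over all ordered
   pairs [(i, j)] of the squared minors. *)
rewrite -(ler_pMn2r (n := 2))// -subr_ge0.
have -> : (\sum_i F i ^+ 2) * (\sum_j G j ^+ 2) *+ 2
    - (\sum_i F i * G i) ^+ 2 *+ 2 = \sum_i \sum_j (F i * G j - F j * G i) ^+ 2.
  transitivity (\sum_i \sum_j (F i ^+ 2 * G j ^+ 2 + F j ^+ 2 * G i ^+ 2
                               - F i * G i * (F j * G j) *+ 2)).
    have prodE (H K : I -> R) :
        (\sum_i H i) * (\sum_j K j) = \sum_i \sum_j H i * K j.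
      by rewrite mulr_suml; apply: eq_bigr => i _; rewrite mulr_sumr.
    (* Swapping the indices in one of the two copies of the double sum produces the mirrored term
       [F j ^+ 2 * G i ^+ 2]. *)
    rewrite expr2 2!prodE mulr2n {2}exchange_big /= -big_split -sumrMnl -sumrB.
    apply: eq_bigr => i _; rewrite -big_split -sumrMnl -sumrB /=.
    by apply: eq_bigr => j _.
  by apply: eq_bigr => i _; apply: eq_bigr => j _; ring.
by apply: sumr_ge0 => i _; apply: sumr_ge0 => j _; exact: sqr_ge0.
Qed.

Section Modulus.
Variables (R : realType) (p q : nat).
Local Notation Cl := (clifford R p q).
Implicit Types (x y mu : Cl) (c K : R).

Lemma modulus_ge0 x : 0 <= modulus x.
Proof. exact: sqrtr_ge0. Qed.

Lemma modulus_sqr x : modulus x ^+ 2 = \sum_A coef x A ^+ 2.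
Proof. by rewrite sqr_sqrtr// sumr_ge0// => A _; exact: sqr_ge0. Qed.

Lemma cl_coefD x y A : coef (x + y) A = coef x A + coef y A.
Proof. by rewrite /coef ffunE. Qed.

Lemma cl_coefZ c x A : coef (c *: x) A = c * coef x A.
Proof. by rewrite /coef ffunE. Qed.

Lemma cl_coefM x y C : coef (x * y) C =
  \sum_A blade_sign R A (symdiff A C) * (coef x A * coef y (symdiff A C)).
Proof. by rewrite /coef ffunE. Qed.

Lemma modulusZ c x : modulus (c *: x) = `|c| * modulus x.
Proof.
rewrite /modulus -sqrtr_sqr -sqrtrM ?sqr_ge0// mulr_sumr; congr Num.sqrt.
by apply: eq_bigr => A _; rewrite cl_coefZ exprMn.
Qed.

Lemma modulusD x y : modulus (x + y) <= modulus x + modulus y.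
Proof.
rewrite -(@ler_pXn2r _ 2) ?nnegrE ?addr_ge0 ?modulus_ge0//.
rewrite sqrrD !modulus_sqr.
under eq_bigr => A _ do rewrite cl_coefD sqrrD.
rewrite 2!big_split /= lerD2r lerD2l sumrMnl lerMn2r /=.
apply: le_trans (ler_norm _) _; exact: cauchy_schwarz_sum.
Qed.

Lemma modulus1 : modulus (1 : Cl) = 1.
Proof.
rewrite /modulus (bigD1 finset.set0) //= big1 => [|A /negPf A0].
  by rewrite /coef ffunE eqxx expr1n addr0 sqrtr1.
by rewrite /coef ffunE A0 expr0n.
Qed.

Lemma blade_sign_norm (A B : {set 'I_(p + q)}) : `|blade_sign R A B| = 1.
Proof.
rewrite /blade_sign normr_prod big1 // => i _.
rewrite normr_prod big1 // => j _; apply/eqP.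
by rewrite -sqr_norm_eq1 expr2 swap_sign_sqr.
Qed.

(** For fixed [C], the map sending [A] to [symdiff A C] permutes the blades and the signs have
    square 1, so Cauchy-Schwarz applies to each coefficient with constant 1. *)
Lemma cl_coefM_le x y C : `|coef (x * y) C| <= modulus x * modulus y.
Proof.
rewrite cl_coefM; pose F A := blade_sign R A (symdiff A C) * coef x A.
rewrite (eq_bigr (fun A => F A * coef y (symdiff A C))) => [|A _]; last first.
  by rewrite mulrA.
apply: le_trans (cauchy_schwarz_sum _ _) _.
rewrite le_eqVlt; apply/orP; left; apply/eqP; congr (Num.sqrt _ * Num.sqrt _).
  apply: eq_bigr => A _; rewrite exprMn -[X in X * _]real_normK ?num_real//.
  by rewrite blade_sign_norm expr1n mul1r.
rewrite [RHS](reindex_inj (can_inj (symdiffK C))) /=.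
by apply: eq_bigr => A _; rewrite symdiffC.
Qed.

(** Summing [2 ^ (p + q)] squares gives the square root of that number as factor; it is weakened to
    [2 ^ (p + q)], the factor in the theorem. *)
Lemma modulus_le x K : 0 <= K -> (forall A, `|coef x A| <= K) ->
  modulus x <= 2 ^+ (p + q) * K.
Proof.
move=> K0 xK; have cn0 : 0 <= 2 ^+ (p + q) * K by rewrite mulr_ge0 ?exprn_ge0.
rewrite -(@ler_pXn2r _ 2) ?nnegrE ?modulus_ge0// modulus_sqr.
apply: (@le_trans _ _ (\sum_(A : {set 'I_(p + q)}) K ^+ 2)).
  by apply: ler_sum => A _; rewrite -real_normK ?num_real// ler_pXn2r.
have cardE : #|{set 'I_(p + q)}| = (2 ^ (p + q))%N.
  by rewrite -cardsT -finset.powersetT card_powerset cardsT card_ord.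
rewrite sumr_const cardE exprMn -[leLHS]mulr_natl natrX.
rewrite ler_wpM2r ?sqr_ge0// expr2 ler_peMl ?exprn_ge0// exprn_ege1//.
by rewrite ler1n.
Qed.

Lemma C_mu_ge0 mu : 0 <= C_mu mu.
Proof. exact: sqrtr_ge0. Qed.

Lemma C_h_ge0 mu b : 0 <= C_h mu b.
Proof. by rewrite mulr_ge0 ?powR_ge0. Qed.

(** The triangle inequality leaves [|cos| + |sin| |mu|], and Cauchy-Schwarz in the plane bounds this
    since [cos^2 + sin^2 = 1]. *)
Lemma modulus_cis mu theta : modulus (cl_cis mu theta) <= C_mu mu.
Proof.
apply: le_trans (modulusD _ _) _; rewrite !modulusZ modulus1 mulr1.
rewrite -(@ler_pXn2r _ 2) ?nnegrE ?C_mu_ge0 ?addr_ge0 ?mulr_ge0 ?modulus_ge0//.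
rewrite /C_mu sqr_sqrtr ?addr_ge0 ?sqr_ge0//.
have := cos2Dsin2 theta; rewrite -(real_normK (num_real (cos theta))).
rewrite -(real_normK (num_real (sin theta))).
move: `|cos theta| `|sin theta| (modulus mu) => c s u cs1.
(* The two-dimensional Lagrange identity: [(c^2 + s^2)(1 + u^2) - (c + s u)^2 = (c u - s)^2]. *)
rewrite -subr_ge0 [X in 0 <= X](_ : _ = (c * u - s) ^+ 2) ?sqr_ge0//.
by rewrite -[1 + u ^+ 2]mul1r -[X in X * _ - _]cs1; ring.
Qed.

End Modulus.

(** * Measurability of the transform *)

Lemma measurable_fun_Rintegral d1 d2 (T1 : measurableType d1)
    (T2 : measurableType d2) (R : realType)
    (m : {sigma_finite_measure set T1 -> \bar R}) (h : T1 * T2 -> R) :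
  measurable_fun setT h ->
  measurable_fun setT (fun y => \int[m]_x h (x, y)).
Proof.
move=> /measurable_EFinP mh; rewrite /Rintegral.
under eq_fun do rewrite integralE.
(* Tonelli treats the positive and negative parts separately; sections with infinite integral are
   covered because [fine] is measurable and sends infinite values to 0. *)
apply: (@measurableT_comp _ _ _ _ _ _ (@fine R)); first exact: fine_measurable.
apply: emeasurable_funB.
  rewrite (_ : (fun y => _) = fubini_G m (EFin \o h)^\+%E).
    exact: measurable_fun_fubini_tonelli_G (measurable_funepos mh) _.
  apply/funext => y; apply: eq_integral => x _.
  by rewrite !funeposE.
rewrite (_ : (fun y => _) = fubini_G m (EFin \o h)^\-%E).
  exact: measurable_fun_fubini_tonelli_G (measurable_funeneg mh) _.
apply/funext => y; apply: eq_integral => x _.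
by rewrite !funenegE.
Qed.

Section Measurability.
Variables (R : realType) (p q : nat).
Local Notation Cl := (clifford R p q).
Local Notation space := (Rn R (p + q)).
Implicit Types (mu : Cl) (f g : space -> Cl).

Section any_domain.
Context d (T : measurableType d).
Implicit Types u v : T -> Cl.

Lemma measurable_modulus u :
  (forall A, measurable_fun setT (fun t => coef (u t) A)) ->
  measurable_fun setT (fun t => modulus (u t)).
Proof.
move=> mu_; rewrite /modulus.
have sqrtm : measurable_fun setT (@Num.sqrt R).
  by apply: continuous_measurable_fun; exact: sqrt_continuous.
apply: (measurableT_comp sqrtm); apply: measurable_sum => A.
by apply: measurable_funX; exact: mu_.
Qed.

Lemma measurable_coefM u v :
  (forall A, measurable_fun setT (fun t => coef (u t) A)) ->
  (forall A, measurable_fun setT (fun t => coef (v t) A)) ->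
  forall A, measurable_fun setT (fun t => coef (u t * v t) A).
Proof.
move=> mu_ mv A; under eq_fun do rewrite cl_coefM.
apply: measurable_sum => B; apply: measurable_funM => //.
by apply: measurable_funM; [exact: mu_|exact: mv].
Qed.

Lemma measurable_cis mu (theta : T -> R) : measurable_fun setT theta ->
  forall A, measurable_fun setT (fun t => coef (cl_cis mu (theta t)) A).
Proof.
move=> mtheta A; rewrite /cl_cis; under eq_fun do rewrite cl_coefD !cl_coefZ.
apply: measurable_funD; apply: measurable_funM => //.
  apply: measurableT_comp mtheta.
  by apply: continuous_measurable_fun; exact: continuous_cos.
apply: measurableT_comp mtheta.
by apply: continuous_measurable_fun; exact: continuous_sin.
Qed.

End any_domain.

Lemma measurable_dotp :
  measurable_fun [set: space * space] (fun z => dotp z.1 z.2 : R).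
Proof.
apply: measurable_sum => l; apply: measurable_funM.
  apply: (measurableT_comp (@measurable_coordinate R (p + q) l)).
  exact: measurable_fst.
apply: (measurableT_comp (@measurable_coordinate R (p + q) l)).
exact: measurable_snd.
Qed.

(** Joint measurability in [(t, xi)] is what allows [t] to be integrated out by Tonelli's
    theorem. *)
Lemma measurable_kernel mu f : cl_measurable f -> forall A,
  measurable_fun [set: space * space]
    (fun z => coef (f z.1 * cl_cis mu (- dotp z.1 z.2)) A).
Proof.
move=> mf; apply: measurable_coefM => A.
  by apply: measurableT_comp (mf A) _; exact: measurable_fst.
apply: measurable_cis; apply: measurableT_comp measurable_dotp.
exact: oppr_measurable.
Qed.

Lemma measurable_kernel_section mu f xi : cl_measurable f -> forall A,
  measurable_fun [set: space]
    (fun t => coef (f t * cl_cis mu (- dotp t xi)) A).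
Proof.
by move=> mf A; exact: measurable_fun_pair1 (measurable_kernel mu mf A).
Qed.

Lemma cl_measurable_fourier mu f :
  cl_measurable f -> cl_measurable (fourier mu f).
Proof.
move=> mf A; under eq_fun do rewrite /coef ffunE.
pose k (z : space * space) := coef (f z.1 * cl_cis mu (- dotp z.1 z.2)) A.
have mk : measurable_fun setT k by exact: measurable_kernel.
exact: (@measurable_fun_Rintegral _ _ _ _ _ lebesgue k mk).
Qed.

End Measurability.

(** * Norm estimates for the transform *)

Section FourierTransform.
Variables (R : realType) (p q : nat).
Local Notation Cl := (clifford R p q).
Local Notation space := (Rn R (p + q)).
Implicit Types (mu : Cl) (f g : space -> Cl) (E T Omega : set space).
Implicit Types a b : \bar R.

(** Turns the truncation used in [concentrated] into multiplication by an indicator, a form suited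
    to Minkowski and to additivity of the transform. *)
Lemma cl_norm_restrict b E f :
  Lnorm lebesgue b ((fun t => (modulus (f t))%:E) \_ E) =
  cl_norm b (fun t => \1_E t *: f t).
Proof.
apply: eq_Lnorm => t; rewrite epatch_indic /= modulusZ.
by rewrite ger0_norm ?indicE ?ler0n// -EFinM mulrC.
Qed.

Lemma cl_measurable_indic E f : measurable E -> cl_measurable f ->
  cl_measurable (fun t => \1_E t *: f t).
Proof.
move=> mE mf A; under eq_fun do rewrite cl_coefZ.
by apply: measurable_funM => //; exact: measurable_indic.
Qed.

Lemma le_cl_norm a f g : (0 < a)%E -> cl_measurable f -> cl_measurable g ->
  (forall t, modulus (f t) <= modulus (g t)) -> (cl_norm a f <= cl_norm a g)%E.
Proof.
move=> a0 mf mg fg.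
apply: (@le_Lnorm _ _ _ lebesgue a (fun t => modulus (f t))
  (fun t => modulus (g t)) a0 (measurable_modulus mf) (measurable_modulus mg)).
by move=> t; rewrite !ger0_norm ?modulus_ge0.
Qed.

Lemma modulus_indic_le E f t : modulus (\1_E t *: f t) <= modulus (f t).
Proof.
rewrite modulusZ ler_piMl ?modulus_ge0// indicE ger0_norm ?ler0n//.
by rewrite lern1 leq_b1.
Qed.

Lemma mem_L_indic a E f : (0 < a)%E -> measurable E -> mem_L a f ->
  mem_L a (fun t => \1_E t *: f t).
Proof.
move=> a0 mE [mf foo]; split; first exact: cl_measurable_indic.
apply: le_lt_trans foo; apply: le_cl_norm a0 (cl_measurable_indic mE mf) mf _.
by move=> t; exact: modulus_indic_le.
Qed.

Lemma cl_norm1 f : cl_norm 1 f = (\int[lebesgue]_t (modulus (f t))%:E)%E.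
Proof.
rewrite /cl_norm Lnorm1; apply: eq_integral => t _.
by rewrite gee0_abs// lee_fin modulus_ge0.
Qed.

Lemma integrable_modulus f : mem_L 1 f ->
  lebesgue.-integrable setT (fun t => (modulus (f t))%:E).
Proof.
move=> [mf foo]; apply/integrableP; split.
  by apply/measurable_EFinP; exact: measurable_modulus.
by move: foo; rewrite /cl_norm Lnorm1.
Qed.

Lemma coef_kernel_le mu f xi A t :
  `|coef (f t * cl_cis mu (- dotp t xi)) A| <= C_mu mu * modulus (f t).
Proof.
apply: le_trans (cl_coefM_le _ _ _) _; rewrite mulrC.
by rewrite ler_wpM2r ?modulus_ge0// modulus_cis.
Qed.

Lemma integrable_kernel mu f xi A : mem_L 1 f ->
  lebesgue.-integrable setT
    (EFin \o (fun t => coef (f t * cl_cis mu (- dotp t xi)) A)).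
Proof.
move=> f1.
have Cf := integrableZl measurableT (C_mu mu) (integrable_modulus f1).
apply: (le_integrable measurableT _ _ Cf).
  by apply/measurable_EFinP; apply: measurable_kernel_section; case: f1.
move=> t _; rewrite /comp -EFinM !abse_EFin lee_fin.
by apply: le_trans (coef_kernel_le _ _ _ _ _) _; exact: ler_norm.
Qed.

(** Additivity of the real integral requires integrable coefficients; membership in [L^1] supplies
    this, the kernel being bounded by [C_mu mu]. *)
Lemma fourierD mu f g xi : mem_L 1 f -> mem_L 1 g ->
  fourier mu (fun t => f t + g t) xi = fourier mu f xi + fourier mu g xi.
Proof.
move=> f1 g1; apply/ffunP => A; rewrite !ffunE.
rewrite -RintegralD//; last 2 first.
- exact: integrable_kernel.
- exact: integrable_kernel.
by apply: eq_Rintegral => t _; rewrite mulrDl cl_coefD.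
Qed.

(** Each coefficient of the transform is at most [C_mu mu] times the [L^1]-norm of [f]; passing from
    coefficients to the modulus costs the factor [2 ^+ (p + q)]. *)
Lemma modulus_fourier_le mu f xi : mem_L 1 f ->
  ((modulus (fourier mu f xi))%:E <=
   (C_mu mu * 2 ^+ (p + q))%:E * cl_norm 1 f)%E.
Proof.
move=> f1; have [mf foo] := f1.
have ffin : cl_norm 1 f \is a fin_num by rewrite ge0_fin_numE// Lnorm_ge0.
rewrite -(fineK ffin) -EFinM lee_fin [C_mu mu * _]mulrC -mulrA.
apply: modulus_le; first by rewrite mulr_ge0 ?C_mu_ge0// fine_ge0// Lnorm_ge0.
move=> A; rewrite /coef ffunE -lee_fin EFin_normr_Rintegral//; last first.
  exact: integrable_kernel.
rewrite EFinM (fineK ffin) cl_norm1 -ge0_integralZl//; last 3 first.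
- by apply/measurable_EFinP; exact: measurable_modulus.
- by move=> t _; rewrite lee_fin modulus_ge0.
- by rewrite lee_fin C_mu_ge0.
have mk : measurable_fun setT
    (EFin \o (fun t => coef (f t * cl_cis mu (- dotp t xi)) A)).
  by apply/measurable_EFinP; exact: measurable_kernel_section.
apply: le_trans (le_abse_integral _ measurableT mk) _.
apply: (ge0_le_integral _ measurableT).
- by move=> t _; exact: abse_ge0.
- exact: measurableT_comp mk.
- apply: measurable_funeM.
  by apply/measurable_EFinP; exact: measurable_modulus.
by move=> t _; rewrite /comp abse_EFin -EFinM lee_fin coef_kernel_le.
Qed.

(** The triangle inequality for the modulus reduces this to Minkowski for real functions. *)
Lemma cl_normD b f g : (1 <= b)%E -> cl_measurable f -> cl_measurable g ->
  (cl_norm b (fun t => f t + g t)%R <= cl_norm b f + cl_norm b g)%E.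
Proof.
move=> b1 mf mg; have b0 : (0 < b)%E by exact: lt_le_trans b1.
have mmf := measurable_modulus mf; have mmg := measurable_modulus mg.
apply: le_trans (eminkowski lebesgue mmf mmg b1).
apply: (@le_Lnorm _ _ _ lebesgue b (fun t => modulus (f t + g t))
  ((fun t => modulus (f t)) \+ (fun t => modulus (g t))) b0).
- apply: measurable_modulus => A; under eq_fun do rewrite cl_coefD.
  exact: measurable_funD (mf A) (mg A).
- exact: measurable_funD.
move=> t; rewrite ger0_norm ?modulus_ge0//.
by apply: le_trans (modulusD _ _) _; exact: ler_norm.
Qed.

Lemma indic_split E f : f = fun t => \1_E t *: f t + \1_(~` E) t *: f t.
Proof.
apply/funext => t; rewrite !indicE in_setC.
by case: (t \in E); rewrite /= scale0r scale1r ?addr0 ?add0r.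
Qed.

(** The main term: the transform of the truncated function is bounded by a constant, whose norm over
    [Omega] gives one measure factor; Hoelder on [T] gives the other. *)
Lemma cl_norm_fourier_indic mu a b T Omega f :
  measurable T -> measurable Omega -> (1 <= a)%E -> (a^-1 + b^-1 = 1)%E ->
  mem_L 1 f ->
  (cl_norm b (fun xi => \1_Omega xi *: fourier mu (fun t => \1_T t *: f t) xi)
   <= (C_mu mu * 2 ^+ (p + q))%:E * lebesgue T `^ fine b^-1
      * lebesgue Omega `^ fine b^-1 * cl_norm a f)%E.
Proof.
move=> mT mO a1 ab f1; have [mf foo] := f1.
have b1 := conjugate_ge1 a1 ab; have b0 : (0 < b)%E by exact: lt_le_trans b1.
have h1 := mem_L_indic lte01 mT f1; have [mh hoo] := h1.
set h := fun t => _ in h1 mh hoo *.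
(* The pointwise bound is a real number because [f] is in [L^1], even when [T] has infinite
   measure. *)
have hfin : cl_norm 1 h \is a fin_num by rewrite ge0_fin_numE// Lnorm_ge0.
have C0 : 0 <= C_mu mu * 2 ^+ (p + q) by rewrite mulr_ge0 ?C_mu_ge0 ?exprn_ge0.
have K0 : 0 <= C_mu mu * 2 ^+ (p + q) * fine (cl_norm 1 h).
  by rewrite mulr_ge0// fine_ge0// Lnorm_ge0.
have h_le : (cl_norm 1 h <= lebesgue T `^ fine b^-1 * cl_norm a f)%E.
  apply: le_trans (hoelder_indic lebesgue a1 ab mT (measurable_modulus mf)).
  rewrite le_eqVlt; apply/orP; left; apply/eqP; apply: eq_Lnorm => t /=.
  by rewrite modulusZ ger0_norm// indicE ler0n.
have hO := Lnorm_indic_le lebesgue b1 mO K0.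
apply: (@le_trans _ _ ((C_mu mu * 2 ^+ (p + q) * fine (cl_norm 1 h))%:E *
    lebesgue Omega `^ fine b^-1)%E); last first.
  rewrite EFinM fineK// [leRHS]muleAC; apply: lee_wpmul2r.
    exact: poweR_ge0.
  by rewrite -muleA lee_wpmul2l// lee_fin.
apply: le_trans hO.
apply: (@le_Lnorm _ _ _ lebesgue b
  (fun xi => modulus (\1_Omega xi *: fourier mu h xi)) _ b0).
- apply: measurable_modulus.
  exact: cl_measurable_indic mO (cl_measurable_fourier mu mh).
- by apply: measurable_funM; [exact: measurable_cst|exact: measurable_indic].
move=> xi; rewrite modulusZ normrM normr_id mulrC [leRHS]normrM ler_wpM2r//.
rewrite ger0_norm ?modulus_ge0// ger0_norm//.
by rewrite -lee_fin EFinM fineK//; exact: modulus_fourier_le.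
Qed.

End FourierTransform.

Theorem theorem4p4 (R : realType) (p q : nat) (mu : clifford R p q)
    (a b : \bar R) (T Omega : set (Rn R (p + q))) (epsT epsO : R)
    (f : Rn R (p + q) -> clifford R p q) :
  mu ^+ 2 = -1 ->
  measurable T -> measurable Omega ->
  (1 <= a)%E -> (a^-1 + b^-1 = 1)%E ->
  hausdorff_young mu a b (C_h mu b) ->
  epsO < 1 ->
  ~ {ae lebesgue, forall t, f t = 0} ->
  mem_L 1 f -> mem_L a f ->
  concentrated epsT T a f ->
  concentrated epsO Omega b (fourier mu f) ->
  (cl_norm b (fourier mu f) <=
   ((C_mu mu * 2 ^+ (p + q))%:E * lebesgue T `^ fine b^-1
      * lebesgue Omega `^ fine b^-1 + (C_h mu b * epsT)%:E)
   * (1 - epsO)^-1%:E * cl_norm a f)%E.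
Proof.
move=> _ mT mO a1 ab HY eO1 _ f1 fa fT fO.
have a0 : (0 < a)%E by exact: lt_le_trans a1.
have b1 := conjugate_ge1 a1 ab; have b0 : (0 < b)%E by exact: lt_le_trans b1.
have fafin : cl_norm a f \is a fin_num.
  by rewrite ge0_fin_numE ?Lnorm_ge0//; case: fa.
have [mT' mO'] := (measurableC mT, measurableC mO).
set Ff := fourier mu f.
have mFf : cl_measurable Ff by apply: cl_measurable_fourier; case: f1.
(* Hausdorff-Young for [f] itself yields this finiteness, which the final subtraction of [epsO * N]
   requires. *)
have Nfin : cl_norm b Ff \is a fin_num.
  rewrite ge0_fin_numE ?Lnorm_ge0//; apply: le_lt_trans (HY _ f1 fa) _.
  by rewrite lte_mul_pinfty ?lee_fin ?C_h_ge0//; case: fa.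
set h := fun t => \1_T t *: f t; set g := fun t => \1_(~` T) t *: f t.
have h1 : mem_L 1 h by exact: mem_L_indic.
have g1 : mem_L 1 g by exact: mem_L_indic.
have ga : mem_L a g by exact: mem_L_indic.
have FfE : Ff = fun xi => fourier mu h xi + fourier mu g xi.
  by apply/funext => xi; rewrite -fourierD// -indic_split.
set N := cl_norm b Ff in Nfin *.
set M := cl_norm b (fun xi => \1_Omega xi *: Ff xi).
have N_le : (N <= M + epsO%:E * N)%E.
  rewrite {1}/N (indic_split Omega Ff); apply: le_trans (cl_normD b1 _ _) _.
  - exact: cl_measurable_indic.
  - exact: cl_measurable_indic.
  by rewrite leeD2l// -cl_norm_restrict.
have M_le : (M <= ((C_mu mu * 2 ^+ (p + q))%:E * lebesgue T `^ fine b^-1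
      * lebesgue Omega `^ fine b^-1 + (C_h mu b * epsT)%:E) * cl_norm a f)%E.
  (* Distributivity is legitimate in the extended reals: [cl_norm a f] and the second summand are
     finite, while the measure term may be infinite. *)
  rewrite muleDl//; last by rewrite fin_num_adde_defl.
  have mF u : mem_L 1 u ->
      cl_measurable (fun xi => \1_Omega xi *: fourier mu u xi).
    case=> mmu _.
    exact: cl_measurable_indic mO (cl_measurable_fourier mu mmu).
  rewrite /M FfE; under [X in cl_norm b X]eq_fun do rewrite scalerDr.
  apply: le_trans (cl_normD b1 (mF _ h1) (mF _ g1)) _; apply: leeD.
    exact: cl_norm_fourier_indic.
  (* For the part of [f] off [T], the restriction to [Omega] is dropped so that Hausdorff-Young
     applies; concentration of [f] then bounds the norm of [g]. *)
  apply: (@le_trans _ _ (cl_norm b (fourier mu g))).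
    apply: (le_cl_norm b0 (mF _ g1)) => [|xi]; last exact: modulus_indic_le.
    by apply: cl_measurable_fourier; case: g1.
  apply: le_trans (HY _ g1 ga) _; rewrite (EFinM (C_h mu b)) -muleA.
  by rewrite lee_wpmul2l ?lee_fin ?C_h_ge0// -cl_norm_restrict.
(* Since [1 - epsO] is positive and [N] is finite, the goal reduces to [N - epsO * N <= M], a
   rearrangement of [N_le]. *)
rewrite muleAC lee_pdivlMr ?subr_gt0//; apply: le_trans M_le.
by rewrite muleC EFinB muleBl// mul1e leeBlDr ?fin_numM.
Qed.
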